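(* Let $k\geq 1$ and $n\geq 2k+1$ be integers. Then $\operatorname{sdepth}(I(C_n^k)/I(P_n^k))\geq\left\lceil\frac{n+k+1}{2k+1}\right\rceil$.
   Context: $K$ is a field and $S=K[x_1,\dots,x_n]$ is the polynomial ring. $P_n^k$ denotes the $k$-th power of the path on the vertex set $\{1,\dots,n\}$: for $1\le i<j\le n$, $\{i,j\}$ is an edge if and only if $j-i\le k$. $C_n^k$ denotes the $k$-th power of the cycle on $\{1,\dots,n\}$ ($n\ge 3$): for $1\le i<j\le n$, $\{i,j\}$ is an edge if and only if $j-i\le k$ or $j-i\ge n-k$. For a graph $G$ on $\{1,\dots,n\}$, the edge ideal is $I(G)=(x_ix_j:\{i,j\}\text{ an edge of }G)\subset S$; thus $I(P_n^k)\subset I(C_n^k)$. Stanley depth: let $M$ be a finitely generated $\mathbb{Z}^n$-graded $S$-module. A Stanley decomposition of $M$ is a presentation of the $K$-vector space $M$ as a finite direct sum $\mathcal{D}: M=\bigoplus_{i=1}^s v_iK[W_i]$, where each $v_i\in M$ is homogeneous, $W_i\subseteq\{x_1,\dots,x_n\}$, $v_iK[W_i]$ is the $K$-subspace generated by all $v_iw$ with $w$ a monomial in $K[W_i]$, and $v_iK[W_i]$ is a free $K[W_i]$-module. Put $\operatorname{sdepth}(\mathcal{D})=\min_i |W_i|$, and $\operatorname{sdepth}(M)=\max\{\operatorname{sdepth}(\mathcal{D}):\mathcal{D}\text{ a Stanley decomposition of }M\}$. *)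

(* Defs.v *)
From HB Require Import structures.
From mathcomp Require Import all_boot all_order all_algebra.
From mathcomp Require Import ring_quotient generic_quotient archimedean.
From mathcomp Require Import mpoly.
From mathcomp Require Import boolp.

Set Implicit Arguments.
Unset Strict Implicit.
Unset Printing Implicit Defensive.

Import GRing.Theory.

Local Open Scope ring_scope.
Local Open Scope quotient_scope.

Section GradedModule.
Variables (K : fieldType) (n : nat).

Definition mnm_degree (m : 'X_{1..n}) : {ffun 'I_n -> int} :=
  [ffun i => (m i)%:Z].

(* A finitely generated Z^n-graded module: [gm_comp a] is the component of
   degree [a]; [gm_decomp] and [gm_direct] say that the module is the direct
   sum of its components. *)
Record gradedModule := GradedModule {
  gm_sort :> lmodType {mpoly K[n]};
  gm_comp : {ffun 'I_n -> int} -> gm_sort -> Prop;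
  gm_comp0 : forall a, gm_comp a 0;
  gm_compD : forall a x y, gm_comp a x -> gm_comp a y -> gm_comp a (x + y);
  gm_compZ : forall a (c : K) x, gm_comp a x -> gm_comp a (c%:MP *: x);
  gm_compX : forall a m x,
    gm_comp a x -> gm_comp (a + mnm_degree m) ('X_[m] *: x);
  gm_decomp : forall x, exists (s : seq {ffun 'I_n -> int}) (f : _ -> gm_sort),
    [/\ uniq s, forall a, gm_comp a (f a) & x = \sum_(a <- s) f a];
  gm_direct : forall (s : seq {ffun 'I_n -> int}) (f : _ -> gm_sort),
    uniq s -> (forall a, gm_comp a (f a)) -> \sum_(a <- s) f a = 0 ->
    forall a, a \in s -> f a = 0;
  gm_fingen : exists (r : nat) (g : 'I_r -> gm_sort),
    forall x, exists c : 'I_r -> {mpoly K[n]}, x = \sum_i c i *: g i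
}.

Definition homogeneous (M : gradedModule) (x : M) : Prop :=
  exists a, gm_comp a x.

(* membership in the subalgebra K[W], where [i \in W] stands for x_i \in W *)
Definition in_subalg (W : {set 'I_n}) (p : {mpoly K[n]}) : Prop :=
  forall m, m \in msupp p -> forall i, m i != 0%N -> i \in W.

Definition stanley_space (M : gradedModule) (v : M) (W : {set 'I_n}) (x : M)
    : Prop :=
  exists2 p, in_subalg W p & x = p *: v.

Record stanleyDecomp (M : gradedModule) := StanleyDecomp {
  sd_size : nat;
  sd_gen : 'I_sd_size -> M;
  sd_vars : 'I_sd_size -> {set 'I_n};
  sd_homog : forall i, homogeneous (sd_gen i);
  sd_free : forall i p,
    in_subalg (sd_vars i) p -> p *: sd_gen i = 0 -> p = 0;
  sd_direct : forall x : M, exists! u : {ffun 'I_sd_size -> M},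
    (forall i, stanley_space (sd_gen i) (sd_vars i) (u i)) /\ x = \sum_i u i
}.
Arguments sd_size {M}.
Arguments sd_gen {M}.
Arguments sd_vars {M}.

(* Since #|W| <= n, the default value n only matters for the empty
   decomposition, i.e. for the zero module. *)
Definition sdepth_decomp (M : gradedModule) (D : stanleyDecomp M) : nat :=
  \big[minn/n]_(i < sd_size D) #|sd_vars D i|.

Definition sdepth (M : gradedModule) : nat :=
  \max_(d < n.+1 | `[< exists D : stanleyDecomp M, sdepth_decomp D = d >]) d.

Lemma sdepth_decomp_le (M : gradedModule) (D : stanleyDecomp M) :
  (sdepth_decomp D <= n)%N.
Proof.
rewrite /sdepth_decomp; elim/big_rec: _ => // i x _ xn.
by rewrite geq_min xn orbT.
Qed.

Lemma sdepth_ge (M : gradedModule) (D : stanleyDecomp M) :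
  (sdepth_decomp D <= sdepth M)%N.
Proof.
have Dn : (sdepth_decomp D < n.+1)%N by rewrite ltnS sdepth_decomp_le.
by apply: (bigmax_sup (Ordinal Dn)) => //; apply/asboolP; exists D.
Qed.

Lemma sdepth_attained (M : gradedModule) (D0 : stanleyDecomp M) :
  exists D : stanleyDecomp M, sdepth_decomp D = sdepth M.
Proof.
have D0n : (sdepth_decomp D0 < n.+1)%N by rewrite ltnS sdepth_decomp_le.
have PD0 : `[< exists D : stanleyDecomp M, sdepth_decomp D = Ordinal D0n >].
  by apply/asboolP; exists D0.
rewrite /sdepth (bigmax_eq_arg (Ordinal D0n)) //.
by case: arg_maxnP => // d /asboolP[D Dd] _; exists D.
Qed.

End GradedModule.

(* The library's submodClosed does not provide closure under opposite, which the
   quotient needs. *)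
Record submodule (R : pzRingType) (V : lmodType R) := Submodule {
  sm_pred :> {pred V};
  sm_closed : submod_closed sm_pred
}.

HB.instance Definition _ (R : pzRingType) (V : lmodType R)
  (J : submodule V) := GRing.isSubmodClosed.Build R V (sm_pred J) (sm_closed J).

Notation sm_quot J := (Quotient.quot (GRing.ZmodClosed.clone _ (sm_pred J) _)).

Section LmodQuotient.
Variables (R : pzRingType) (V : lmodType R) (J : submodule V).
Local Notation Q := (sm_quot J).

Definition quot_scale (a : R) : Q -> Q := lift_op1 Q ( *:%R a).

Lemma pi_scale a : {morph \pi_Q : x / a *: x >-> quot_scale a x}.
Proof.
move=> x; unlock quot_scale; apply/eqP; rewrite -Quotient.idealrBE -scalerBr.
by apply: rpredZ; rewrite Quotient.idealrBE reprK.
Qed.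

Lemma quot_scaleA a b x :
  quot_scale a (quot_scale b x) = quot_scale (a * b) x.
Proof. by rewrite -[x]reprK -!pi_scale scalerA. Qed.

Lemma quot_scale1 : left_id 1 quot_scale.
Proof. by move=> x; rewrite -[x]reprK -pi_scale scale1r. Qed.

Lemma quot_scaleDr : right_distributive quot_scale +%R.
Proof.
move=> a x y; rewrite -[x]reprK -[y]reprK.
by rewrite -[_ + _]raddfD -!pi_scale scalerDr raddfD.
Qed.

Lemma quot_scaleDl x : {morph quot_scale^~ x : a b / a + b}.
Proof. by move=> a b; rewrite -[x]reprK -!pi_scale scalerDl raddfD. Qed.

HB.instance Definition _ := GRing.Zmodule_isLmodule.Build R Q
  quot_scaleA quot_scale1 quot_scaleDr quot_scaleDl.

Lemma pi_scaleE a x : \pi_Q (a *: x) = a *: \pi_Q x.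
Proof. exact: pi_scale. Qed.

Lemma pi_eq0 x : (\pi_Q x == 0) = (x \in J).
Proof. by rewrite -[0](raddf0 (\pi_Q)) -Quotient.idealrBE subr0. Qed.

End LmodQuotient.

Section IdealQuotient.
Variables (R : comNzRingType) (I J : submodule R^o).

Definition ideal_sort := {x : R^o | x \in I}.

HB.instance Definition _ := [isSub of ideal_sort for @sval _ _].
HB.instance Definition _ := [Choice of ideal_sort by <:].
HB.instance Definition _ := [SubChoice_isSubLmodule of ideal_sort by <:].

Definition ideal_trace : {pred ideal_sort} := fun x => val x \in J.

Lemma ideal_traceE x : (x \in ideal_trace) = (val x \in J).
Proof. by []. Qed.

Lemma ideal_trace_closed : submod_closed ideal_trace.
Proof.
split=> [|a x y]; rewrite !ideal_traceE; first by rewrite raddf0 rpred0.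
by move=> Jx Jy; rewrite linearP rpredD ?rpredZ.
Qed.

Canonical ideal_trace_submodule := Submodule ideal_trace_closed.

(* the R-module I / (I :&: J), i.e. I / J when J is contained in I *)
Definition ideal_quot : lmodType R := sm_quot ideal_trace_submodule.

End IdealQuotient.

Section MonomialIdealQuotient.
Variables (K : fieldType) (n : nat).
Local Notation S := {mpoly K[n]}.

Definition monomial_ideal (I : submodule S^o) : Prop :=
  forall p : S, p \in I -> forall m, p@_m *: 'X_[m] \in I.

Definition fingen_ideal (I : submodule S^o) : Prop :=
  exists (r : nat) (g : 'I_r -> S), (forall i, g i \in I) /\
    forall p : S, p \in I -> exists c : 'I_r -> S, p = \sum_i c i * g i.

Variables I J : submodule S^o.
Hypotheses (monI : monomial_ideal I) (monJ : monomial_ideal J).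
Hypothesis fgI : fingen_ideal I.
Local Notation M := (ideal_quot I J).
Local Notation toM := (\pi_(sm_quot (ideal_trace_submodule I J))).

(* the degree a component of I / J: the classes of the polynomials in I all of
   whose monomials have degree a *)
Definition ideal_quot_comp (a : {ffun 'I_n -> int}) (x : M) : Prop :=
  exists2 p : ideal_sort I,
    x = toM p & forall m, m \in msupp (val p : S) -> mnm_degree m = a.

Local Notation comp := ideal_quot_comp.

Lemma quot_comp0 a : comp a 0.
Proof.
exists 0; first by rewrite raddf0.
by move=> m; rewrite raddf0 msupp0 in_nil.
Qed.

Lemma quot_compD a x y : comp a x -> comp a y -> comp a (x + y).
Proof.
move=> [p -> dp] [q -> dq]; exists (p + q); first by rewrite raddfD.
move=> m; rewrite raddfD => /msuppD_le; rewrite mem_cat => /orP[].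
  exact: dp.
exact: dq.
Qed.

Lemma quot_compZ a (c : K) x : comp a x -> comp a (c%:MP *: x).
Proof.
move=> [p -> dp]; exists (c%:MP *: p); first by rewrite -pi_scaleE.
move=> m; rewrite linearZ_LR => mp; apply: dp.
by apply: (@msuppZ_le _ _ c); rewrite -mul_mpolyC.
Qed.

Lemma mnm_degreeD m1 m2 :
  mnm_degree (m1 + m2)%MM = mnm_degree m1 + mnm_degree m2 :> {ffun 'I_n -> int}.
Proof. by apply/ffunP=> i; rewrite !ffunE mnmDE PoszD. Qed.

Lemma quot_compX a m x : comp a x -> comp (a + mnm_degree m) ('X_[m] *: x).
Proof.
move=> [p -> dp]; exists ('X_[m] *: p); first by rewrite -pi_scaleE.
move=> m'; rewrite linearZ_LR => /msuppM_le /allpairsP[[m1 m2] /= [+ h2 ->]].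
by rewrite msuppX inE => /eqP->; rewrite mnm_degreeD (dp _ h2) addrC.
Qed.

Definition degree_part (a : {ffun 'I_n -> int}) (p : S) : S :=
  \sum_(m <- msupp p | mnm_degree m == a) p@_m *: 'X_[m].

Lemma degree_part_in a p : p \in I -> degree_part a p \in I.
Proof. by move=> Ip; apply: rpred_sum => m _; apply: monI. Qed.

Lemma quot_decomp x : exists (s : seq {ffun 'I_n -> int}) (f : _ -> M),
  [/\ uniq s, forall a, comp a (f a) & x = \sum_(a <- s) f a].
Proof.
rewrite -[x]reprK; set p : ideal_sort I := repr x.
pose g a : ideal_sort I :=
  exist (fun q => q \in I) _ (degree_part_in a (valP p)).
exists (undup (map (@mnm_degree n) (msupp (val p : S)))), (fun a => toM (g a)).
split; first exact: undup_uniq.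
  move=> a; exists (g a) => // m /msupp_sum_le.
  case/flatten_mapP=> m'; rewrite mem_filter => /andP[/eqP <- _].
  by move/msuppZ_le; rewrite msuppX inE => /eqP->.
rewrite -raddf_sum; congr toM; apply: val_inj; rewrite raddf_sum /=.
rewrite [LHS](mpolyE (val p : S)) /degree_part (exchange_big_dep xpredT) //=.
rewrite big_seq [RHS]big_seq; apply: eq_bigr => m mp.
rewrite (eq_bigl (pred1 (mnm_degree m))) => [|a]; last by rewrite eq_sym.
rewrite -big_filter filter_pred1_uniq ?undup_uniq ?mem_undup ?map_f //.
by rewrite big_seq1.
Qed.

Lemma quot_direct (s : seq {ffun 'I_n -> int}) (f : _ -> M) :
  uniq s -> (forall a, comp a (f a)) -> \sum_(a <- s) f a = 0 ->
  forall a, a \in s -> f a = 0.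
Proof.
move=> us hf sum0 a sa.
have {hf} /choice[y hy] a' : exists q : ideal_sort I, f a' = toM q /\
    forall m, m \in msupp (val q : S) -> mnm_degree m = a'.
  by have [q ? ?] := hf a'; exists q.
have Jy : \sum_(b <- s) val (y b) \in J.
  move: sum0; under eq_bigr do rewrite (hy _).1.
  rewrite -raddf_sum => /eqP; rewrite pi_eq0 ideal_traceE.
  by rewrite raddf_sum.
rewrite (hy a).1; apply/eqP; rewrite pi_eq0 ideal_traceE.
rewrite [val (y a)](mpolyE (val (y a) : S)) big_seq.
apply: rpred_sum => m ma.
suff -> : (val (y a) : S)@_m = (\sum_(b <- s) val (y b) : S)@_m by exact: monJ.
rewrite raddf_sum /= (bigD1_seq a) //= big1 ?addr0 // => b ba.
apply: memN_msupp_eq0; apply: contraNN ba => mb.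
by rewrite -((hy a).2 m ma) ((hy b).2 m mb).
Qed.

Lemma quot_fingen : exists (r : nat) (g : 'I_r -> M),
  forall x, exists c : 'I_r -> S, x = \sum_i c i *: g i.
Proof.
have [r [g [gI hg]]] := fgI.
exists r, (fun i => toM (exist (fun q => q \in I) (g i) (gI i))) => x.
have [c pE] := hg _ (valP (repr x)).
exists c; rewrite -[LHS]reprK; under eq_bigr do rewrite -pi_scaleE.
rewrite -raddf_sum; congr toM; apply: val_inj; rewrite raddf_sum pE.
by apply: eq_bigr.
Qed.

Definition monomial_quot : gradedModule K n :=
  GradedModule quot_comp0 quot_compD quot_compZ quot_compX quot_decomp
    quot_direct quot_fingen.

End MonomialIdealQuotient.

Record graph (n : nat) := Graph {
  edge :> rel 'I_n;
  edge_sym : forall i j, edge i j = edge j i;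
  edge_irr : forall i, edge i i = false
}.

Section Powers.
Variables (n k : nat).

(* the vertex set 1, ..., n is shifted to 0, ..., n - 1, which does not change
   the differences *)
Definition path_power_rel : rel 'I_n := fun i j =>
  (0 < `|i - j| <= k)%N.

Definition cycle_power_rel : rel 'I_n := fun i j =>
  ((0 < `|i - j|) && ((`|i - j| <= k) || (n - k <= `|i - j|)))%N.

Lemma path_power_sym i j : path_power_rel i j = path_power_rel j i.
Proof. by rewrite /path_power_rel distnC. Qed.

Lemma path_power_irr i : path_power_rel i i = false.
Proof. by rewrite /path_power_rel distnn. Qed.

Lemma cycle_power_sym i j : cycle_power_rel i j = cycle_power_rel j i.
Proof. by rewrite /cycle_power_rel distnC. Qed.

Lemma cycle_power_irr i : cycle_power_rel i i = false.
Proof. by rewrite /cycle_power_rel distnn. Qed.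

Definition path_power := Graph path_power_sym path_power_irr.
Definition cycle_power := Graph cycle_power_sym cycle_power_irr.

End Powers.

Section EdgeIdeal.
Variables (K : fieldType) (n : nat).
Local Notation S := {mpoly K[n]}.
Implicit Type G : graph n.

Definition edge_monomial (e : 'I_n * 'I_n) : S := 'X_(e.1) * 'X_(e.2).

Definition edge_ideal_pred G : {pred S} := fun p =>
  `[< exists c : 'I_n * 'I_n -> S,
        p = \sum_(e | edge G e.1 e.2) c e * edge_monomial e >].

Lemma edge_ideal_predP G p :
  reflect (exists c : 'I_n * 'I_n -> S,
             p = \sum_(e | edge G e.1 e.2) c e * edge_monomial e)
          (p \in edge_ideal_pred G).
Proof. exact: asboolP. Qed.

Lemma edge_ideal_closed G : @submod_closed S S^o (edge_ideal_pred G).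
Proof.
split=> [|a p q].
  apply/edge_ideal_predP; exists (fun=> 0).
  by rewrite big1 // => e _; rewrite mul0r.
move=> /edge_ideal_predP[c ->] /edge_ideal_predP[d ->]; apply/asboolP.
exists (fun e => a * c e + d e); rewrite scaler_sumr -big_split /=.
by apply: eq_bigr => e _; rewrite mulrDl -mulrA.
Qed.

Definition edge_ideal G : submodule S^o := Submodule (@edge_ideal_closed G).

Lemma edge_monomial_in G e : edge G e.1 e.2 -> edge_monomial e \in edge_ideal G.
Proof.
move=> Ge; apply/edge_ideal_predP; exists (fun e' => (e' == e)%:R).
rewrite (bigD1 e) //= eqxx mul1r big1 ?addr0 // => e' /andP[_ /negPf->].
by rewrite mul0r.
Qed.

Lemma edge_ideal_monomial G : monomial_ideal (edge_ideal G).
Proof.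
move=> p /edge_ideal_predP[c ->] m.
rewrite raddf_sum /= scaler_suml.
apply: (rpred_sum (S := edge_ideal G)) => e Ge.
rewrite {1}/edge_monomial -mpolyXD; set u := (_ + _)%MM.
have [mu|] := boolP (m \in msupp (c e * 'X_[u])); last first.
  by move/memN_msupp_eq0 ->; rewrite scale0r rpred0.
have /allpairsP[[m1 m2] /= [_ + ->]] := msuppM_le mu.
rewrite msuppX inE => /eqP->; rewrite mpolyXD -mul_mpolyC mulrA.
by apply: (rpredZ (s := edge_ideal G)); rewrite mpolyXD edge_monomial_in.
Qed.

Lemma edge_ideal_fingen G : fingen_ideal (edge_ideal G).
Proof.
exists #|[pred e | edge G e.1 e.2]|, (fun i => edge_monomial (enum_val i)).
split=> [i|p]; first by apply: edge_monomial_in; have := enum_valP i.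
move=> /edge_ideal_predP[c ->]; exists (fun i => c (enum_val i)).
rewrite -(big_enum_val (A := [pred e | edge G e.1 e.2])
  (fun e => c e * edge_monomial e)).
exact: eq_bigl.
Qed.

(* the Z^n-graded module I(G) / I(H), for H a subgraph of G *)
Definition edge_ideal_quot G H : gradedModule K n :=
  monomial_quot (@edge_ideal_monomial G) (@edge_ideal_monomial H)
    (@edge_ideal_fingen G).

Lemma path_cycle_edge_ideal k p :
  p \in edge_ideal (path_power n k) -> p \in edge_ideal (cycle_power n k).
Proof.
move=> /edge_ideal_predP[c ->].
apply: (rpred_sum (S := edge_ideal (cycle_power n k))) => e /andP[e0 ek].
apply: (rpredZ (s := edge_ideal (cycle_power n k))); apply: edge_monomial_in.
by rewrite /= /cycle_power_rel e0 ek.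
Qed.

End EdgeIdeal.

(* Main.v *)
(* A basis of I(C_n^k)/I(P_n^k) is given by the monomials whose support s
   contains an edge of the cycle power but none of the path power.  If such
   supports are partitioned into intervals [A, B] of the subset order, then the
   spaces x_A K[B] form a Stanley decomposition, because a monomial lies in
   x_A K[B] exactly when its support lies in [A, B].

   With i = min s and j = max s, such an s is {i, j} together with a set of
   vertices strictly between i + k and j - k, independent in the path power,
   and j - i >= n - k.  Independent sets of a path power on [a, b) split
   recursively: either one vertex v of s lies in (a, a + k], and the rest of s
   lies in [v + k + 1, b); or none does, and a may be freely added to or removed
   from s, whose other elements lie in [a + k + 1, b).  In both cases the tops B
   gain a vertex while at most 2k + 1 positions are used up, so that
   |B| >= ceil((b - a) / (2k + 1)), and
   2 + ceil((n - 3k - 1) / (2k + 1)) = ceil((n + k + 1) / (2k + 1)). *)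
Require Import Defs.
From mathcomp Require Import all_boot all_order all_algebra archimedean.
From mathcomp Require Import mpoly boolp zify.
Import GRing.Theory Num.Theory.
Local Open Scope ring_scope.

Set Implicit Arguments.
Unset Strict Implicit.
Unset Printing Implicit Defensive.

(** * Partitions of families of sets into intervals *)

Section IntervalPartition.
Variable T : finType.
Implicit Types (D : pred {set T}) (d : nat) (s : {set T}).

Definition in_interval s (p : {set T} * {set T}) : bool :=
  (p.1 \subset s) && (s \subset p.2).

(** The single count equation says that members of [D] are covered exactly once and other sets
    never. Only tops are bounded: |B| is the number of variables of x_A K[B]. *)
Definition interval_partition D d (P : seq ({set T} * {set T})) : Prop :=
  (forall p, p \in P -> p.1 \subset p.2 /\ (d <= #|p.2|)%N) /\
  (forall s, count (in_interval s) P = D s).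

Definition partitionable D d : Prop := exists P, interval_partition D d P.

Lemma interval_partition_mem D d P p s :
  interval_partition D d P -> p \in P -> in_interval s p -> D s.
Proof.
case=> _ cP pP sp; have := cP s; case: (D s) => // /eqP.
by rewrite -leqn0 leqNgt -has_count; case/hasP; exists p.
Qed.

Lemma partitionable_le D d d' :
  (d' <= d)%N -> partitionable D d -> partitionable D d'.
Proof.
move=> dd [P [bP cP]]; exists P; split=> // p /bP[-> /(leq_trans dd)->] //.
Qed.

Lemma partitionable_pred0 d : partitionable pred0 d.
Proof. by exists [::]. Qed.

(** The partitions can be concatenated: at most one [DI i] holds at [s], so at most one list
    contributes to its count. *)
Lemma partitionable_union (I : finType) (DI : I -> pred {set T}) D d :
  (forall s, D s = [exists i, DI i s]) ->
  (forall s i j, DI i s -> DI j s -> i = j) ->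
  (forall i, partitionable (DI i) d) -> partitionable D d.
Proof.
move=> DE DIinj /choice[P hP].
exists (flatten [seq P i | i <- enum I]); split=> [p /flatten_mapP[i _]|s].
  exact: (hP i).1.
rewrite count_flatten -map_comp sumnE big_map DE big_enum /=.
rewrite (eq_bigr (fun i => DI i s : nat)) => [|i _]; last exact: (hP i).2.
case: existsP => [[i Di]|noD]; last first.
  rewrite big1 // => i _; apply/eqP; rewrite eqb0; apply/negP => Di.
  by case: noD; exists i.
rewrite (bigD1 i) //= Di big1 // => j ji.
by case: (boolP (DI j s)) => // Dj; rewrite (DIinj _ _ _ Di Dj) eqxx in ji.
Qed.

Variables (D : pred {set T}) (x : T) (d : nat).
Hypothesis Dx : forall s, D s -> x \notin s.

Lemma interval_partition_notin P p :
  interval_partition D d P -> p \in P -> (x \notin p.1) * (x \notin p.2).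
Proof.
move=> hP pP; have [pp _] := hP.1 p pP.
by split; apply: Dx; apply: (interval_partition_mem hP pP);
  rewrite /in_interval subxx pp.
Qed.

(** Both ends of each interval receive [x], which lay in neither, so every top grows by one. *)
Lemma partitionable_join :
  partitionable D d -> partitionable (fun s => (x \in s) && D (s :\ x)) d.+1.
Proof.
move=> [P hP]; exists [seq (x |: p.1, x |: p.2) | p <- P].
split=> [_ /mapP[p pP ->] /=|s].
  by rewrite setUS ?(hP.1 p pP).1 // cardsU1 (interval_partition_notin hP pP);
    case: (hP.1 p pP).
rewrite count_map; case: (boolP (x \in s)) => /= xs; last first.
  rewrite (eq_count (a2 := pred0)) ?count_pred0 // => p /=.
  by rewrite /in_interval /= subUset sub1set (negPf xs).
rewrite -hP.2; apply: eq_in_count => p pP; rewrite /in_interval /=.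
have [x1 x2] := interval_partition_notin hP pP.
by rewrite subUset sub1set xs subsetD1 x1 andbT subDset.
Qed.

(** Only the tops receive [x], so each interval now covers its sets both with and without [x]. *)
Lemma partitionable_cone :
  partitionable D d -> partitionable (fun s => D (s :\ x)) d.+1.
Proof.
move=> [P hP]; exists [seq (p.1, x |: p.2) | p <- P].
split=> [_ /mapP[p pP ->] /=|s].
  rewrite subsetU ?(hP.1 p pP).1 ?orbT // cardsU1.
  by rewrite (interval_partition_notin hP pP); case: (hP.1 p pP).
rewrite count_map -hP.2; apply: eq_in_count => p pP; rewrite /in_interval /=.
have [x1 x2] := interval_partition_notin hP pP.
by rewrite subsetD1 x1 andbT subDset.
Qed.

End IntervalPartition.

(** * Independent sets of a path power inside a window *)

Section Spaced.
Variables n k : nat.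

Definition spaced (a b : nat) (s : {set 'I_n}) : bool :=
  [forall i in s, (a <= i < b)%N] &&
  [forall i in s, forall j in s, (i < j)%N ==> (i + k < j)%N].

Lemma spacedP a b (s : {set 'I_n}) :
  reflect ((forall i, i \in s -> (a <= i < b)%N) /\
           (forall i j, i \in s -> j \in s -> (i < j)%N -> (i + k < j)%N))
          (spaced a b s).
Proof.
apply: (iffP andP) => -[h1 h2]; split.
- exact/forall_inP.
- move=> i j si sj; move/forall_inP: h2.
  by move=> /(_ i si)/forall_inP/(_ j sj)/implyP.
- exact/forall_inP.
- by apply/forall_inP=> i si; apply/forall_inP=> j sj; apply/implyP; apply: h2.
Qed.

Lemma ceil_div_step (m m' : nat) : (m <= m' + (2 * k + 1))%N ->
  ((m + 2 * k) %/ (2 * k + 1) <= ((m' + 2 * k) %/ (2 * k + 1)).+1)%N.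
Proof.
move=> mm; have k0 : (0 < 2 * k + 1)%N by lia.
apply: (@leq_trans ((m' + 2 * k + (2 * k + 1)) %/ (2 * k + 1))).
  by apply: leq_div2r; lia.
by rewrite divnDr ?divnn ?k0 ?addn1 ?dvdnn.
Qed.

(* The bound is the ceiling of (b - a) / (2k + 1), and 0 when b <= a. *)
Lemma spaced_partitionable a b : (b <= n)%N ->
  partitionable (spaced a b) ((b - a + 2 * k) %/ (2 * k + 1)).
Proof.
move=> bn; have [m] := ubnP (b - a); elim: m a => // m IH a bam.
have [ba|ab] := leqP b a.
  (* An empty window contains only the empty set, and the bound is the floor of 2k / (2k + 1), which
     is 0. *)
  exists [:: (set0, set0)]; split=> [p|s].
    rewrite inE => /eqP->; split; rewrite ?subxx //=.
    by rewrite (eqP ba) add0n divn_small ?cards0 //; lia.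
  rewrite /= /in_interval /= sub0set subset0 addn0; congr nat_of_bool.
  apply/eqP/spacedP => [->|[h _]]; first by split=> [i|i j]; rewrite inE.
  by apply/setP => i; rewrite inE; apply/negP => /h; lia.
(* The index v = a stands for the cone, where a is free. *)
pose DI (v : 'I_n) (s : {set 'I_n}) :=
  if (a < v <= a + k)%N && (v < b)%N
  then (v \in s) && spaced (v + k).+1 b (s :\ v)
  else (v == a :> nat) && spaced (a + k).+1 b (s :\ v).
have an : (a < n)%N by lia.
apply: (@partitionable_union _ _ DI).
- move=> s; apply/idP/existsP => [|[v]].
  + case/spacedP => h1 h2.
    case: (pickP [pred v : 'I_n | (v \in s) && (a < v <= a + k)%N]) => [v|].
      case/andP=> vs av; have := h1 v vs => /andP[_ vb]; exists v.
      rewrite /DI av vb /= vs; apply/spacedP; split=> [i|i j].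
        rewrite !inE => /andP[iv si]; have := h1 i si; have := h2 i v si vs.
        have := h2 v i vs si; move: iv; rewrite -val_eqE /=; lia.
      by rewrite !inE => /andP[_ si] /andP[_ sj]; apply: h2.
    move=> none; exists (Ordinal an); rewrite /DI /= ltnn eqxx /=.
    apply/spacedP; split=> [i|i j].
      rewrite !inE -val_eqE /= => /andP[iv si]; have := h1 i si.
      by have := none i; rewrite /= si; lia.
    by rewrite !inE => /andP[_ si] /andP[_ sj]; apply: h2.
  + rewrite /DI; case: ifP => [/andP[av vb] /andP[vs]|_ /andP[/eqP va]].
      case/spacedP=> h1 h2.
      have h3 i : i \in s -> i = v \/ (v + k < i < b)%N.
        move=> si; case: (eqVneq i v) => [|iv]; first by left.
        by right; apply: h1; rewrite !inE iv.
      apply/spacedP; split=> [i /h3[->|]|i j si sj]; [lia|lia|].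
      case: (h3 i si) => [->|iv]; case: (h3 j sj) => [->|jv]; try lia.
      by apply: h2; rewrite !inE ?si ?sj ?andbT;
        apply/eqP => E; move: iv jv; rewrite ?E; lia.
    case/spacedP=> h1 h2.
    have h3 i : i \in s -> i = v \/ (a + k < i < b)%N.
      move=> si; case: (eqVneq i v) => [|iv]; first by left.
      by right; apply: h1; rewrite !inE iv.
    apply/spacedP; split=> [i /h3[->|]|i j si sj]; [lia|lia|].
    case: (h3 i si) => [->|iv]; case: (h3 j sj) => [->|jv]; try lia.
    by apply: h2; rewrite !inE ?si ?sj ?andbT;
      apply/eqP => E; move: iv jv; rewrite ?E; lia.
(* Disjointness: [DI v s] puts all elements of [s] other than [v] beyond a + k. *)
- have key s (v w : 'I_n) : DI v s -> w \in s -> (a < w <= a + k)%N -> w = v.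
    move=> + ws aw; rewrite /DI; case: (eqVneq w v) => // wv; case: ifP.
      move=> av /andP[_ /spacedP[/(_ w)]]; rewrite !inE wv ws => /(_ isT); lia.
    move=> _ /andP[_ /spacedP[/(_ w)]]; rewrite !inE wv ws => /(_ isT); lia.
  have cases s v : DI v s -> (v \in s /\ (a < v <= a + k)%N) \/ v = a :> nat.
    rewrite /DI; case: ifP => [/andP[av _] /andP[vs _]|_ /andP[/eqP va _]].
      by left.
    by right.
  move=> s v w Dv Dw; case: (cases s v Dv) => [[vs av]|va].
    exact: key Dw vs av.
  case: (cases s w Dw) => [[ws aw]|wa]; first by rewrite (key s v w).
  by apply: val_inj; rewrite /= va wa.
move=> v; rewrite /DI.
case: (boolP ((a < v <= a + k)%N && (v < b)%N)) => [/andP[av vb]|_].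
  (* Since v <= a + k, restarting at v + k + 1 uses up at most 2k + 1 positions. *)
  apply: (@partitionable_le _ _ ((b - (v + k).+1 + 2 * k) %/ (2 * k + 1)).+1).
    by apply: ceil_div_step; lia.
  apply: partitionable_join; last by apply: IH; lia.
  by move=> s /spacedP[h _]; apply/negP => /h; lia.
case: eqP => va /=; last exact: partitionable_pred0.
apply: (@partitionable_le _ _ ((b - (a + k).+1 + 2 * k) %/ (2 * k + 1)).+1).
  by apply: ceil_div_step; lia.
apply: partitionable_cone; last by apply: IH; lia.
by move=> s /spacedP[h _]; apply/negP => /h; lia.
Qed.

End Spaced.

(** * Supports with an edge of the cycle power and none of the path power *)

Section CycleSupports.
Variables n k : nat.
Hypothesis hk : (1 <= k)%N.
Hypothesis hn : (2 * k + 1 <= n)%N.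

Definition contains_edge (G : graph n) (s : {set 'I_n}) : bool :=
  [exists i in s, exists j in s, edge G i j].

Lemma contains_edgeP (G : graph n) (s : {set 'I_n}) :
  reflect (exists i j, [/\ i \in s, j \in s & edge G i j]) (contains_edge G s).
Proof.
apply: (iffP exists_inP) => [[i si /exists_inP[j sj ij]]|[i [j [si sj ij]]]].
  by exists i, j.
by exists i => //; apply/exists_inP; exists j.
Qed.

Lemma cycle_supports_partitionable :
  partitionable
    (fun s => contains_edge (cycle_power n k) s
              && ~~ contains_edge (path_power n k) s)
    ((n - (3 * k + 1) + 2 * k) %/ (2 * k + 1)).+2.
Proof.
pose DI (p : 'I_n * 'I_n) (s : {set 'I_n}) :=
  (n - k + p.1 <= p.2)%N && ((p.1 \in s) && ((p.2 \in s :\ p.1) &&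
    spaced k (p.1 + k).+1 (p.2 - k) (s :\ p.1 :\ p.2))).
have DIP p s : DI p s -> [/\ (n - k + p.1 <= p.2)%N, p.1 \in s, p.2 \in s &
    forall x : 'I_n, x \in s -> [\/ x = p.1, x = p.2 |
      (p.1 + k < x)%N /\ (x + k < p.2)%N]].
  case/and4P=> h ps; rewrite 2!inE => /andP[_ ps'] /spacedP[hx _].
  split=> // x xs.
  have [->|x1] := eqVneq x p.1; first by constructor 1.
  have [->|x2] := eqVneq x p.2; first by constructor 2.
  by constructor 3; have := hx x; rewrite !inE x1 x2 xs => /(_ isT); lia.
apply: (@partitionable_union _ _ DI).
- move=> s; apply/idP/existsP => [|[p Dp]].
  + case/andP=> /contains_edgeP[i [j [si sj ij]]] noP.
    have far x y : x \in s -> y \in s -> x != y -> (`|x - y| > k)%N.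
      move=> sx sy xy; rewrite ltnNge; apply: contra noP => xyk.
      apply/contains_edgeP; exists x, y; split=> //=.
      rewrite /path_power_rel xyk andbT.
      by move: xy; rewrite -val_eqE /=; lia.
    wlog lij : i j si sj ij / (i < j)%N.
      move=> W; case: (ltngtP i j) => h; first exact: (W i j).
        by apply: (W j i) => //; rewrite edge_sym.
      by move: ij; rewrite /= /cycle_power_rel; lia.
    have ij' : i != j by rewrite -val_eqE /=; lia.
    exists (i, j); rewrite /DI /=; have := far i j si sj ij'.
    move: ij; rewrite /= /cycle_power_rel => ij fij.
    rewrite si !inE sj eq_sym ij' /=; apply/andP; split; first by lia.
    have := ltn_ord j => jn.
    (* An element x < i would satisfy x + k < i, whence j >= n - k + i > n; an element x > j would
       exceed j + k >= n. So the others lie between i and j, more than k from each. *)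
    apply/spacedP; split=> [x|x y].
      rewrite !inE => /and3P[xj xi xs].
      have := far x i xs si xi; have := far x j xs sj xj.
      have := ltn_ord x; lia.
    rewrite !inE => /and3P[_ _ xs] /and3P[_ _ ys] xy.
    have := far x y xs ys; rewrite -val_eqE /=; lia.
  + have [h p1 p2 hx] := DIP p s Dp; apply/andP; split.
      apply/contains_edgeP; exists p.1, p.2; split=> //=.
      by rewrite /cycle_power_rel; lia.
    (* A path edge cannot use [p.1] or [p.2], which are more than k away from each other and from
       the rest; the rest is spaced. *)
    apply/contains_edgeP => -[x [y [xs ys]]] /=; rewrite /path_power_rel => xy.
    have [[x1 x2] [y1 y2]] : (x != p.1 /\ x != p.2) /\ (y != p.1 /\ y != p.2).
      by rewrite -!val_eqE /=; case: (hx x xs) => [ex|ex|[? ?]];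
        case: (hx y ys) => [ey|ey|[? ?]]; move: xy; rewrite ?ex ?ey; lia.
    case/and4P: Dp => _ _ _ /spacedP[_ sp].
    have := sp x y; have := sp y x; rewrite !inE xs ys x1 x2 y1 y2.
    by move=> /(_ isT isT) + /(_ isT isT); lia.
(* By [DIP] the pair consists of the least and the greatest element of [s], hence is unique. *)
- move=> s [i j] [i' j'] /DIP[/= h si sj hx] /DIP[/= h' si' sj' hx'].
  congr pair; apply: val_inj => /=.
    by case: (hx i' si') => [->//|/(congr1 val)/= e|?];
      case: (hx' i si) => [->//|/(congr1 val)/= e'|?]; lia.
  by case: (hx j' sj') => [/(congr1 val)/= e|->//|?];
    case: (hx' j sj) => [/(congr1 val)/= e'|->//|?]; lia.
move=> [i j]; rewrite /DI /=.
case: (boolP (n - k + i <= j)%N) => [h|_] /=; last exact: partitionable_pred0.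
have ij : i != j by rewrite -val_eqE /=; lia.
apply: (@partitionable_join _ (fun s : {set 'I_n} => (j \in s) &&
  spaced k (i + k).+1 (j - k) (s :\ j)) i).
  move=> s /andP[_ /spacedP[hs _]]; apply/negP => si.
  by have := hs i; rewrite !inE si ij => /(_ isT); lia.
apply: partitionable_join.
  by move=> s /spacedP[hs _]; apply/negP => /hs; lia.
have jn := ltn_ord j.
(* The window from i + k + 1 to j - k has length at least n - (3k + 1), because j - i >= n - k. *)
apply: partitionable_le (spaced_partitionable _ _ _); last by lia.
by apply: leq_div2r; lia.
Qed.

End CycleSupports.

(** * Monomials and their supports *)

Section MonomialSupport.
Variables (K : fieldType) (n : nat).
Implicit Types (m : 'X_{1..n}) (A : {set 'I_n}).

Definition mnm_support m : {set 'I_n} := [set i | m i != 0%N].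

Definition mnm_of_set A : 'X_{1..n} := [multinom (i \in A : nat) | i < n].

Lemma mnm_supportD m1 m2 :
  mnm_support (m1 + m2)%MM = mnm_support m1 :|: mnm_support m2.
Proof. by apply/setP=> i; rewrite !inE mnmDE addn_eq0 negb_and. Qed.

Lemma mnm_support_of_set A : mnm_support (mnm_of_set A) = A.
Proof. by apply/setP=> i; rewrite !inE mnmE; case: (i \in A). Qed.

Lemma mnm_of_set_le A m : A \subset mnm_support m -> (mnm_of_set A <= m)%MM.
Proof.
move=> Am; apply/mnm_lepP=> i; rewrite mnmE.
by case: (boolP (i \in A)) => // /(subsetP Am); rewrite inE lt0n.
Qed.

Lemma monomial_ideal_mem (I : submodule {mpoly K[n]}^o) (p : {mpoly K[n]}) m :
  monomial_ideal I -> p \in I -> m \in msupp p -> 'X_[m] \in I.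
Proof.
move=> monI Ip mp; have c0 : p@_m != 0 by rewrite mcoeff_eq0 negbK.
have := rpredZ (s := I) ((p@_m)^-1)%:MP (monI p Ip m).
by rewrite -[_ *: _]/(_ * _) mul_mpolyC scalerA mulVf ?scale1r.
Qed.

End MonomialSupport.

(** * From an interval partition to a Stanley decomposition *)

Section StanleyOfIntervals.
Local Open Scope quotient_scope.
Variables (K : fieldType) (n : nat) (I J : submodule {mpoly K[n]}^o).
Hypotheses (monI : monomial_ideal I) (monJ : monomial_ideal J).
Hypothesis fgI : fingen_ideal I.
Variable D : pred {set 'I_n}.
Hypothesis DE : forall m,
  D (mnm_support m) = ('X_[m] \in I) && ('X_[m] \notin J).
Local Notation S := {mpoly K[n]}.
Local Notation M := (monomial_quot monI monJ fgI).
Local Notation toM := (\pi_(sm_quot (ideal_trace_submodule I J))).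

Variables (d : nat) (P : seq ({set 'I_n} * {set 'I_n})).
Hypothesis hP : interval_partition D d P.
Local Notation N := (size P).
Local Notation Q := (tnth (in_tuple P)).

Lemma sum_in_interval s : (\sum_(i < N) in_interval s (Q i))%N = D s.
Proof.
rewrite -hP.2 -sum1_count (big_tnth _ _ P) [RHS]big_mkcond.
by apply: eq_bigr => i _; case: in_interval.
Qed.

Lemma in_interval_inj s (i j : 'I_N) :
  in_interval s (Q i) -> in_interval s (Q j) -> i = j.
Proof.
move=> si sj; apply/eqP; case: eqVneq => // ij.
have := sum_in_interval s; rewrite (bigD1 i) //= (bigD1 j) 1?eq_sym //= si sj.
by case: (D s).
Qed.

Lemma interval_D s (i : 'I_N) : in_interval s (Q i) -> D s.
Proof. by apply: (interval_partition_mem hP); apply: mem_tnth. Qed.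

Lemma interval_sub (i : 'I_N) : (Q i).1 \subset (Q i).2.
Proof. by have [] := hP.1 _ (mem_tnth i (in_tuple P)). Qed.

Lemma interval_mulX (i : 'I_N) (p : S) m : in_subalg (Q i).2 p ->
  m \in msupp (p * 'X_[mnm_of_set (Q i).1]) ->
  in_interval (mnm_support m) (Q i).
Proof.
move=> hp; rewrite (perm_mem (msuppMX _ _)) => /mapP[m' m'p ->].
rewrite /in_interval mnm_supportD mnm_support_of_set subsetUl subUset.
rewrite interval_sub.
by apply/subsetP=> j; rewrite inE => /(hp _ m'p).
Qed.

(** A monomial of one summand has its support in that summand's interval only, so no other summand
    cancels it. It would then lie in the monomial ideal [J], against [DE]. *)
Lemma intervals_independent (r : 'I_N -> S) :
  (forall i, in_subalg (Q i).2 (r i)) ->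
  \sum_i r i * 'X_[mnm_of_set (Q i).1] \in J -> forall i, r i = 0.
Proof.
move=> hr sumJ i; apply/eqP; rewrite -msupp_eq0.
case E: (msupp (r i)) => [//|m l]; have mr : m \in msupp (r i).
  by rewrite E mem_head.
have mI : (mnm_of_set (Q i).1 + m)%MM \in msupp (r i * 'X_[mnm_of_set (Q i).1]).
  by rewrite mcoeff_msupp mcoeffMX -mcoeff_msupp.
have sI := interval_mulX (hr i) mI.
have := interval_D sI; rewrite DE => /andP[_ /negP[]].
apply: (monomial_ideal_mem monJ sumJ).
rewrite mcoeff_msupp raddf_sum /= (bigD1 i) //= big1 ?addr0 -?mcoeff_msupp //.
move=> j ji; apply: memN_msupp_eq0; apply: contraNN ji => mj.
by apply/eqP; apply: in_interval_inj (interval_mulX (hr j) mj) sI.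
Qed.

(** The default 0 is never taken: the bottom of an interval lies in the interval, so its monomial is
    in [I]. *)
Definition interval_gen (i : 'I_N) : ideal_sort I :=
  insubd 0 'X_[mnm_of_set (Q i).1].

Lemma val_interval_gen i : val (interval_gen i) = 'X_[mnm_of_set (Q i).1].
Proof.
apply: insubdK.
have : D (mnm_support (mnm_of_set (Q i).1)).
  by apply: (interval_D (i := i));
    rewrite /in_interval mnm_support_of_set subxx interval_sub.
by rewrite DE => /andP[].
Qed.

Lemma val_interval_sum (r : 'I_N -> S) :
  val (\sum_i r i *: interval_gen i) = \sum_i r i * 'X_[mnm_of_set (Q i).1].
Proof.
rewrite raddf_sum; apply: eq_bigr => i _.
by rewrite -val_interval_gen.
Qed.

Lemma class_interval_sum (r : 'I_N -> S) :
  toM (\sum_i r i *: interval_gen i) = \sum_i r i *: (toM (interval_gen i) : M).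
Proof. by rewrite raddf_sum; apply: eq_bigr => i _; rewrite /= pi_scaleE. Qed.

Lemma interval_sum_eq0 (r : 'I_N -> S) :
  (forall i, in_subalg (Q i).2 (r i)) ->
  \sum_i r i *: (toM (interval_gen i) : M) = 0 -> forall i, r i = 0.
Proof.
move=> hr r0; apply: intervals_independent hr _.
by rewrite -val_interval_sum -ideal_traceE -pi_eq0 class_interval_sum r0.
Qed.

Lemma in_subalgB W (p q : S) :
  in_subalg W p -> in_subalg W q -> in_subalg W (p - q).
Proof.
by move=> hp hq m /msuppB_le; rewrite mem_cat => /orP[/hp|/hq].
Qed.

Lemma in_subalg0 W : in_subalg W (0 : S).
Proof. by move=> m; rewrite msupp0. Qed.

Lemma interval_homogeneous i : homogeneous (toM (interval_gen i) : M).
Proof.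
exists (mnm_degree (mnm_of_set (Q i).1)), (interval_gen i) => // m.
by rewrite val_interval_gen msuppX inE => /eqP->.
Qed.

Lemma interval_free i (p : S) : in_subalg (Q i).2 p ->
  p *: (toM (interval_gen i) : M) = 0 -> p = 0.
Proof.
(* Freeness is independence for the family concentrated at [i]. *)
move=> hp p0; pose r j : S := if j == i then p else 0.
have <- : r i = p by rewrite /r eqxx.
apply: interval_sum_eq0 => [j|].
  by rewrite /r; case: eqP => [->//|_]; apply: in_subalg0.
rewrite (bigD1 i) //= /r eqxx p0 add0r big1 // => j /negPf->.
by rewrite scale0r.
Qed.

Lemma interval_span (x : M) : exists r : 'I_N -> S,
  (forall i, in_subalg (Q i).2 (r i)) /\
  x = \sum_i r i *: (toM (interval_gen i) : M).
Proof.
pose q : S := val (repr x).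
(* The terms of the representative [q] are sorted by the interval containing their support and
   divided by x_A. *)
pose r (i : 'I_N) : S := \sum_(m <- msupp q | in_interval (mnm_support m) (Q i))
  q@_m *: 'X_[(m - mnm_of_set (Q i).1)%MM].
exists r; split=> [i m /msupp_sum_le|].
  case/flatten_mapP=> m'; rewrite mem_filter => /andP[/andP[_ m'B] _].
  move/msuppZ_le; rewrite msuppX inE => /eqP-> j; rewrite mnmBE => mj.
  by apply: (subsetP m'B); rewrite inE; apply: contraNneq mj => ->.
have rE : \sum_i r i * 'X_[mnm_of_set (Q i).1] =
    \sum_(m <- msupp q | D (mnm_support m)) q@_m *: 'X_[m].
  transitivity (\sum_i \sum_(m <- msupp q)
      (q@_m *: 'X_[m]) *+ in_interval (mnm_support m) (Q i)).
    apply: eq_bigr => i _; rewrite mulr_suml [LHS]big_mkcond.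
    apply: eq_bigr => m _.
    case: ifP => // /andP[mA _].
    by rewrite -scalerAl -mpolyXD submK // mnm_of_set_le.
  rewrite exchange_big [RHS]big_mkcond; apply: eq_bigr => m _.
  by rewrite sumrMnr sum_in_interval; case: (D _).
rewrite -class_interval_sum -[LHS]reprK; apply/eqP.
rewrite -subr_eq0 -raddfB pi_eq0 ideal_traceE.
rewrite raddfB /= val_interval_sum rE -/q [X in X - _]mpolyE.
(* What remains are the terms with support outside [D]; being in [I], they lie in [J] and vanish in
   the quotient. *)
rewrite (bigID (fun m => D (mnm_support m))) /= addrAC subrr add0r big_seq_cond.
apply: (rpred_sum (S := J)) => m /andP[mq].
rewrite DE (monomial_ideal_mem monI (valP (repr x)) mq) /= negbK => mJ.
by rewrite -mul_mpolyC; apply: (rpredZ (s := J)).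
Qed.

Lemma interval_direct (x : M) : exists! u : {ffun 'I_N -> M},
  (forall i, stanley_space (toM (interval_gen i) : M) (Q i).2 (u i)) /\
  x = \sum_i u i.
Proof.
have [r [hr xr]] := interval_span x.
exists [ffun i => r i *: (toM (interval_gen i) : M)]; split.
  split=> [i|]; first by rewrite ffunE; exists (r i).
  by rewrite xr; apply: eq_bigr => i _; rewrite ffunE.
move=> u [hu xu].
have {hu} /choice[t ht] : forall i, exists t, in_subalg (Q i).2 t /\
    u i = t *: (toM (interval_gen i) : M).
  by move=> i; have [t ? ?] := hu i; exists t.
(* Uniqueness: the differences of the two coefficient families give an expansion of 0. *)
apply/ffunP=> i; rewrite ffunE (ht i).2; congr (_ *: _); apply/eqP.
rewrite -subr_eq0; apply/eqP; move: i.
apply: interval_sum_eq0 => [i|].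
  by apply: in_subalgB; [apply: hr|apply: (ht i).1].
under eq_bigr do rewrite scalerBl -(ht _).2.
by rewrite sumrB -xr -xu subrr.
Qed.

Definition interval_stanleyDecomp : stanleyDecomp M :=
  StanleyDecomp interval_homogeneous interval_free interval_direct.

End StanleyOfIntervals.

(** * The bound on the Stanley depth *)

Lemma sdepth_ge_partitionable (K : fieldType) (n : nat)
    (I J : submodule {mpoly K[n]}^o)
    (monI : monomial_ideal I) (monJ : monomial_ideal J) (fgI : fingen_ideal I)
    (D : pred {set 'I_n}) (d : nat) :
  (forall m, D (mnm_support m) = ('X_[m] \in I) && ('X_[m] \notin J)) ->
  (d <= n)%N -> partitionable D d ->
  (d <= sdepth (monomial_quot monI monJ fgI))%N.
Proof.
move=> DE dn [P hP].
apply: leq_trans (sdepth_ge (interval_stanleyDecomp monI monJ fgI DE hP)).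
(* The minimum starts from the default n, which is where [dn] enters. *)
rewrite /sdepth_decomp; elim/big_rec: _ => // i x _ dx.
by rewrite leq_min dx andbT; have [] := hP.1 _ (mem_tnth i (in_tuple P)).
Qed.

Lemma edge_ideal_monomialE (K : fieldType) (n : nat) (G : graph n) m :
  ('X_[m] \in edge_ideal K G) = contains_edge G (mnm_support m).
Proof.
apply/idP/contains_edgeP => [/edge_ideal_predP[c mE]|[i [j [mi mj ij]]]].
  have : m \in msupp ('X_[m] : {mpoly K[n]}) by rewrite msuppX mem_head.
  rewrite mE => /msupp_sum_le /flatten_mapP[e].
  rewrite mem_filter => /andP[Ge _].
  rewrite /edge_monomial -mpolyXD => /msuppM_le /allpairsP[[m1 m2] /= [_ + ->]].
  rewrite msuppX inE => /eqP->; exists e.1, e.2.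
  by rewrite !inE !mnmDE !mnm1E !eqxx !addnS.
have le : (U_(i) + U_(j) <= m)%MM.
  apply/mnm_lepP=> l; rewrite mnmDE !mnm1E.
  case: (eqVneq i l) => [il|_]; case: (eqVneq j l) => [jl|_] //=.
  (* Exponent 2 would need a loop. *)
  - by move: ij; rewrite il jl edge_irr.
  - by move: mi; rewrite il inE lt0n.
  - by move: mj; rewrite jl inE lt0n.
rewrite -(submK le) !mpolyXD.
apply: (rpredZ (s := edge_ideal K G)).
exact: (@edge_monomial_in K n G (i, j)).
Qed.

Unset Implicit Arguments.

Theorem proposition5p3 (K : fieldType) (k n : nat)
  (hk : (1 <= k)%N) (hn : (2 * k + 1 <= n)%N) :
  Num.ceil ((n + k + 1)%:R / (2 * k + 1)%:R : rat)
    <= (sdepth (edge_ideal_quot K (cycle_power n k) (path_power n k)))%:Z.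
Proof.
(* For n < 3k + 1 the subtraction truncates and d = 2, still enough since then n + k + 1 <= 2(2k +
   1). *)
pose d := ((n - (3 * k + 1) + 2 * k) %/ (2 * k + 1)).+2.
have k0 : (0 < 2 * k + 1)%N by lia.
have d2 : (n - (3 * k + 1) + 2 * k < (d - 1) * (2 * k + 1))%N.
  by rewrite /d subn1 /= ltn_ceil.
have dn : (d <= n)%N.
  have := leq_trunc_div (n - (3 * k + 1) + 2 * k) (2 * k + 1).
  rewrite /d; set t := (_ %/ _)%N; nia.
rewrite ceil_le_int ler_pdivrMr ?ltr0n // -[_%:~R]/(_%:R) -natrM ler_nat.
(* From [d2], n - k <= (d - 1)(2k + 1); adding 2k + 1 gives the claim. *)
apply: (@leq_trans (d * (2 * k + 1))); first by move: d2; rewrite /d; nia.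
rewrite leq_mul2r; apply/orP; right.
apply: (sdepth_ge_partitionable _ _ _ _ dn
  (cycle_supports_partitionable hk hn)).
by move=> m; rewrite !edge_ideal_monomialE.
Qed.
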